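(* Let $k$ be an algebraically closed field of characteristic $3$ and let $\mathcal{C}_4=k[a_0,a_1,a_2,a_3,a_4,x,z]^{\mathrm{SL}_2(k)}$ be the algebra of covariants of the binary quartic form $f=a_0z^4+a_1xz^3+a_2x^2z^2+a_3x^3z+a_4x^4$. Let $$c_{0,1}=a_2,$$ $$c_{0,6}=a_0^3a_4^3+a_0^2a_2^2a_4^2+a_0a_1a_2^2a_3a_4+a_0a_2^4a_4+2a_0a_2^3a_3^2+2a_1^3a_3^3+2a_1^2a_2^3a_4+a_1^2a_2^2a_3^2,$$ $$c_{4,1}=a_0z^4+a_1xz^3+a_2x^2z^2+a_3x^3z+a_4x^4,$$ $$\begin{aligned}c_{4,3}={}&(a_0a_4^2+2a_1a_3a_4+2a_2^2a_4+a_2a_3^2)x^4+(a_0a_3a_4+a_1a_2a_4+2a_1a_3^2)x^3z\\&+(a_0a_1a_4+a_0a_2a_3+2a_1^2a_3)xz^3+(a_0^2a_4+2a_0a_1a_3+2a_0a_2^2+a_1^2a_2)z^4,\end{aligned}$$ $$\begin{aligned}c_{6,3}={}&(2a_0^2a_3+2a_0a_1a_2+a_1^3)z^6+(2a_0^2a_4+a_0a_1a_3+a_0a_2^2+2a_1^2a_2)xz^5\\&+(a_0a_1a_4+a_0a_2a_3+2a_1^2a_3)x^2z^4+(a_0a_3^2+2a_1^2a_4)x^3z^3\\&+(2a_0a_3a_4+2a_1a_2a_4+a_1a_3^2)x^4z^2+(a_0a_4^2+2a_1a_3a_4+2a_2^2a_4+a_2a_3^2)x^5z\\&+(a_1a_4^2+a_2a_3a_4+2a_3^3)x^6.\end{aligned}$$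 Then $\{c_{0,1},c_{0,6},c_{4,1},c_{4,3},c_{6,3}\}$ is a separating system of $\mathcal{C}_4$.
   Context: For $M\in\mathrm{SL}_2(k)$ define $a'=(a'_0,\dots,a'_4)$ by $f(M\cdot(x,z))=\sum_{i=0}^4 a'_i x^i z^{4-i}$. The group $\mathrm{SL}_2(k)$ acts on the affine space with coordinates $(a_0,\dots,a_4,x,z)$ by sending $(a,(x,z))$ to $(a',M^{-1}\cdot(x,z))$, and $\mathcal{C}_4$ is the ring of polynomials in $k[a_0,\dots,a_4,x,z]$ invariant under all these substitutions. Separating: let $X$ be an affine variety and $G$ a group of automorphisms of $k[X]$. A subset $S\subseteq k[X]^G$ is separating if for every pair of points $u,v\in X$: whenever there is $h\in k[X]^G$ with $h(u)\ne h(v)$, there is $g\in S$ with $g(u)\neq g(v)$. Here $X=\mathbb{A}^5\times\mathbb{A}^2$ with coordinates $(a_0,\dots,a_4,x,z)$ and $G=\mathrm{SL}_2(k)$. *)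

(* Defs.v *)
From HB Require Import structures.
From mathcomp Require Import all_boot all_order all_algebra.
From mathcomp Require Export mpoly.

Set Implicit Arguments.
Unset Strict Implicit.
Unset Printing Implicit Defensive.

Import GRing.Theory.
Local Open Scope ring_scope.

(* Invariants and separating sets on the affine variety X = A^n, whose points  *)
(* are the functions 'I_n -> k and whose coordinate ring is {mpoly k[n]}.      *)
(* G is a set of maps k[X] -> k[X]; it is meant to be a group of automorphisms.*)
Section Separating.

Variables (k : fieldType) (n : nat).
Variable G : ({mpoly k[n]} -> {mpoly k[n]}) -> Prop.

Definition invariant (h : {mpoly k[n]}) : Prop := forall phi, G phi -> phi h = h.

Definition separating (S : {mpoly k[n]} -> Prop) : Prop :=
  (forall g, S g -> invariant g) /\
  (forall u v : 'I_n -> k,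
     (exists h, invariant h /\ h.@[u] <> h.@[v]) ->
     exists g, S g /\ g.@[u] <> g.@[v]).

End Separating.

(* Binary quartic forms are polynomials in x = 'X_0 and z = 'X_1. *)
Section Quartic.

Variable R : comNzRingType.

Definition quartic (a : 'I_5 -> R) : {mpoly R[2]} :=
  \sum_(i < 5) a i *: ('X_0 ^+ i * 'X_1 ^+ (4 - i)).

(* The form f(M . (x, z)). *)
Definition quartic_at (M : 'M[R]_2) (a : 'I_5 -> R) : {mpoly R[2]} :=
  quartic a \mPo [tuple \sum_(j < 2) M i j *: 'X_j | i < 2].

(* The exponent of x ^ i z ^ (4 - i). *)
Definition quartic_mnm (i : 'I_5) : 'X_{1..2} := [multinom [:: i : nat; (4 - i)%N]].

(* The coefficients a' of f(M . (x, z)); see quartic_actE below. *)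
Definition quartic_act (M : 'M[R]_2) (a : 'I_5 -> R) (i : 'I_5) : R :=
  (quartic_at M a)@_(quartic_mnm i).

Lemma quartic_mnmE (i : 'I_5) :
  'X_[quartic_mnm i] = 'X_0 ^+ i * 'X_1 ^+ (4 - i) :> {mpoly R[2]}.
Proof.
rewrite !mpolyXn -mpolyXD; congr ('X_[_]); apply/mnmP => j.
rewrite mnmDE !mulmnE !mnm1E (mnm_nth 0%N) /=.
case: j => [[|[|//]] lt_j] /=; by rewrite ?mul1n ?mul0n ?addn0.
Qed.

Lemma quartic_at_homog (M : 'M[R]_2) (a : 'I_5 -> R) :
  quartic_at M a \is 4.-homog.
Proof.
rewrite /quartic_at /quartic raddf_sum; apply: rpred_sum => i _ /=.
rewrite linearZ; apply: dhomogZ; rewrite rmorphM !rmorphXn /= !comp_mpolyXU.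
have lin_homog (j : 'I_2) :
    [tuple \sum_(l < 2) M i l *: ('X_l : {mpoly R[2]}) | i < 2]`_j \is 1.-homog.
  rewrite -tnth_nth tnth_mktuple; apply: rpred_sum => l _.
  by apply: dhomogZ; rewrite dhomogX /= mdeg1.
have := dhomogM (dhomogMn i (lin_homog 0)) (dhomogMn (4 - i) (lin_homog 1)).
by rewrite !mul1n subnKC // -ltnS.
Qed.

Lemma quartic_actE (M : 'M[R]_2) (a : 'I_5 -> R) :
  quartic_at M a = quartic (quartic_act M a).
Proof.
have /dhomogP homM := quartic_at_homog M a.
apply/mpolyP => m.
have -> : (quartic (quartic_act M a))@_m
          = \sum_(i < 5) quartic_act M a i * (quartic_mnm i == m)%:R.
  rewrite /quartic raddf_sum; apply: eq_bigr => i _.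
  by rewrite -quartic_mnmE /= mcoeffZ mcoeffX.
have degm : mdeg m = (m ord0 + m (Ordinal (isT : 1 < 2)))%N.
  rewrite mdegE !big_ord_recl big_ord0 addn0; congr (_ + m _)%N; exact: val_inj.
have mE (i : 'I_5) : quartic_mnm i = m -> mdeg m = 4%N /\ m ord0 = i.
  move=> <-; rewrite mdegE !big_ord_recl big_ord0 !(mnm_nth 0%N) /= addn0.
  by rewrite subnKC // -ltnS.
have [d4 | d4] := eqVneq (mdeg m) 4%N; last first.
  rewrite big1 => [|i _]; last first.
    case: (quartic_mnm i =P m) => [/mE[/eqP]|_]; first by rewrite (negPf d4).
    by rewrite mulr0.
  apply/memN_msupp_eq0/negP => /homM /eqP; exact/negP.
have lt5 : (m ord0 < 5)%N by rewrite ltnS -d4 degm leq_addr.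
have m_i : quartic_mnm (Ordinal lt5) = m.
  apply/mnmP => j; rewrite (mnm_nth 0%N) /=.
  case: j => [[|[|//]] lt_j] /=; first by congr (m _); apply: val_inj.
  rewrite -d4 degm addKn; congr (m _); exact: val_inj.
rewrite (bigD1 (Ordinal lt5)) //= /quartic_act m_i eqxx mulr1 big1 ?addr0 //.
move=> i ne_i; case: (quartic_mnm i =P m) => [/mE[_ m0]|_]; last by rewrite mulr0.
by case/eqP: ne_i; apply: val_inj.
Qed.

End Quartic.

(* The coordinates a_0, ..., a_4, x, z on A^5 x A^2 are the variables          *)
(* 0, ..., 4, 5, 6 of {mpoly k[5 + 2]}.                                        *)
Section Covariants.

Variable k : fieldType.

Definition Xa (i : 'I_5) : {mpoly k[5 + 2]} := 'X_(lshift 2 i).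
Definition Xw (j : 'I_2) : {mpoly k[5 + 2]} := 'X_(rshift 5 j).

(* h |-> h(a', M^-1 . (x, z)) *)
Definition SL2_subst (M : 'M[k]_2) (h : {mpoly k[5 + 2]}) : {mpoly k[5 + 2]} :=
  h \mPo [tuple match split s with
                | inl i => quartic_act (map_mx (@mpolyC (5 + 2) k) M) Xa i
                | inr j => \sum_(l < 2) invmx M j l *: Xw l
                end | s < 5 + 2].

Definition SL2_group (phi : {mpoly k[5 + 2]} -> {mpoly k[5 + 2]}) : Prop :=
  exists2 M : 'M[k]_2, \det M = 1 & phi = SL2_subst M.

Local Notation a0 := (Xa 0).
Local Notation a1 := (Xa 1).
Local Notation a2 := (Xa 2).
Local Notation a3 := (Xa 3).
Local Notation a4 := (Xa 4).
Local Notation x := (Xw 0).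
Local Notation z := (Xw 1).

Definition c01 : {mpoly k[5 + 2]} := a2.

Definition c06 : {mpoly k[5 + 2]} :=
  a0 ^+ 3 * a4 ^+ 3 + a0 ^+ 2 * a2 ^+ 2 * a4 ^+ 2
  + a0 * a1 * a2 ^+ 2 * a3 * a4 + a0 * a2 ^+ 4 * a4
  + 2 * a0 * a2 ^+ 3 * a3 ^+ 2 + 2 * a1 ^+ 3 * a3 ^+ 3
  + 2 * a1 ^+ 2 * a2 ^+ 3 * a4 + a1 ^+ 2 * a2 ^+ 2 * a3 ^+ 2.

Definition c41 : {mpoly k[5 + 2]} :=
  a0 * z ^+ 4 + a1 * x * z ^+ 3 + a2 * x ^+ 2 * z ^+ 2 + a3 * x ^+ 3 * z
  + a4 * x ^+ 4.

Definition c43 : {mpoly k[5 + 2]} :=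
  (a0 * a4 ^+ 2 + 2 * a1 * a3 * a4 + 2 * a2 ^+ 2 * a4 + a2 * a3 ^+ 2) * x ^+ 4
  + (a0 * a3 * a4 + a1 * a2 * a4 + 2 * a1 * a3 ^+ 2) * x ^+ 3 * z
  + (a0 * a1 * a4 + a0 * a2 * a3 + 2 * a1 ^+ 2 * a3) * x * z ^+ 3
  + (a0 ^+ 2 * a4 + 2 * a0 * a1 * a3 + 2 * a0 * a2 ^+ 2 + a1 ^+ 2 * a2) * z ^+ 4.

Definition c63 : {mpoly k[5 + 2]} :=
  (2 * a0 ^+ 2 * a3 + 2 * a0 * a1 * a2 + a1 ^+ 3) * z ^+ 6
  + (2 * a0 ^+ 2 * a4 + a0 * a1 * a3 + a0 * a2 ^+ 2 + 2 * a1 ^+ 2 * a2)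
    * x * z ^+ 5
  + (a0 * a1 * a4 + a0 * a2 * a3 + 2 * a1 ^+ 2 * a3) * x ^+ 2 * z ^+ 4
  + (a0 * a3 ^+ 2 + 2 * a1 ^+ 2 * a4) * x ^+ 3 * z ^+ 3
  + (2 * a0 * a3 * a4 + 2 * a1 * a2 * a4 + a1 * a3 ^+ 2) * x ^+ 4 * z ^+ 2
  + (a0 * a4 ^+ 2 + 2 * a1 * a3 * a4 + 2 * a2 ^+ 2 * a4 + a2 * a3 ^+ 2)
    * x ^+ 5 * z
  + (a1 * a4 ^+ 2 + a2 * a3 * a4 + 2 * a3 ^+ 3) * x ^+ 6.

End Covariants.

(* Main.v *)
(* Call two points of A^5 x A^2 indistinguishable if all covariants agree on   *)
(* them.  Points of the same orbit are indistinguishable, and so are a point   *)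
(* and the limits of its orbit under the torus diag(t, 1/t).  Every point is   *)
(* brought to a normal form on which the five covariants can be inverted.      *)
(*   If (x, z) is nonzero it may be taken to be (1, 0), with stabilizer the    *)
(* shifts x -> x + t z, which fix a_2 and a_4 and add a_4 t to a_3.            *)
(* - a_4 <> 0: shift to a_3 = 0; then c_43 gives a_0 and c_63 gives a_1.       *)
(* - a_4 = 0, a_3 <> 0: c_63 = - a_3^3 gives a_3.  If a_2 <> 0, shift to       *)
(*   a_1 = 0, and c_06 = - a_0 a_2^3 a_3^2 gives a_0.  If a_2 = 0, shift to    *)
(*   a_0 = 0, and c_06 = - (a_1 a_3)^3 gives a_1.                              *)
(* - a_4 = a_3 = 0: the torus degenerates the point to (a_2 x^2 z^2, (0, 0)).  *)
(* If (x, z) = 0, a root of the form is moved to infinity, so that a_4 = 0;    *)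
(* a torus element, or the inverse of a degeneration when a_3 = 0, gives       *)
(* a_3 = 1, and the second case applies.                                       *)

From Stdlib Require Import ZArith Ring.
Require Import Defs.
From HB Require Import structures.
From mathcomp Require Import all_boot all_order all_algebra.
From mathcomp Require Import mpoly.
From mathcomp.zify Require Import ssrZ.
From mathcomp.algebra_tactics Require Import common.

Set Implicit Arguments.
Unset Strict Implicit.
Unset Printing Implicit Defensive.

Import GRing.Theory.
Local Open Scope ring_scope.

Record point (R : Type) := Point {
  pa0 : R; pa1 : R; pa2 : R; pa3 : R; pa4 : R; px : R; pz : R }.

Definition map_point (R S : Type) (f : R -> S) (P : point R) : point S :=
  let: Point a0 a1 a2 a3 a4 x z := P in
  Point (f a0) (f a1) (f a2) (f a3) (f a4) (f x) (f z).

Section PointFunctions.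

Variable R : comNzRingType.
Implicit Type P : point R.

Definition quartic_coef P (i : 'I_5) : R :=
  [:: pa0 P; pa1 P; pa2 P; pa3 P; pa4 P]`_i.

Definition vector_coord P (j : 'I_2) : R := [:: px P; pz P]`_j.

Definition coords P (s : 'I_(5 + 2)) : R :=
  match split s with inl i => quartic_coef P i | inr j => vector_coord P j end.

(* The action of [[p, q], [r, s]], whose inverse is taken to be its adjugate. *)
Definition act (p q r s : R) P : point R :=
  let: Point a0 a1 a2 a3 a4 x z := P in
  Point
    (a0 * s ^+ 4 + a1 * q * s ^+ 3 + a2 * q ^+ 2 * s ^+ 2 + a3 * q ^+ 3 * s
     + a4 * q ^+ 4)
    (4 * a0 * r * s ^+ 3 + a1 * (p * s ^+ 3 + 3 * q * r * s ^+ 2)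
     + 2 * a2 * (p * q * s ^+ 2 + q ^+ 2 * r * s)
     + a3 * (3 * p * q ^+ 2 * s + q ^+ 3 * r) + 4 * a4 * p * q ^+ 3)
    (6 * a0 * r ^+ 2 * s ^+ 2 + 3 * a1 * (p * r * s ^+ 2 + q * r ^+ 2 * s)
     + a2 * (p ^+ 2 * s ^+ 2 + 4 * p * q * r * s + q ^+ 2 * r ^+ 2)
     + 3 * a3 * (p ^+ 2 * q * s + p * q ^+ 2 * r) + 6 * a4 * p ^+ 2 * q ^+ 2)
    (4 * a0 * r ^+ 3 * s + a1 * (3 * p * r ^+ 2 * s + q * r ^+ 3)
     + 2 * a2 * (p ^+ 2 * r * s + p * q * r ^+ 2)
     + a3 * (p ^+ 3 * s + 3 * p ^+ 2 * q * r) + 4 * a4 * p ^+ 3 * q)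
    (a0 * r ^+ 4 + a1 * p * r ^+ 3 + a2 * p ^+ 2 * r ^+ 2 + a3 * p ^+ 3 * r
     + a4 * p ^+ 4)
    (s * x - q * z) (p * z - r * x).

(* The covariants of Defs.v are the values of the following functions at the   *)
(* generic point; a general R also covers the points with coordinates in k.    *)
Definition covariant01 P : R := pa2 P.

Definition covariant06 P : R :=
  let: Point a0 a1 a2 a3 a4 x z := P in
  a0 ^+ 3 * a4 ^+ 3 + a0 ^+ 2 * a2 ^+ 2 * a4 ^+ 2
  + a0 * a1 * a2 ^+ 2 * a3 * a4 + a0 * a2 ^+ 4 * a4
  + 2 * a0 * a2 ^+ 3 * a3 ^+ 2 + 2 * a1 ^+ 3 * a3 ^+ 3
  + 2 * a1 ^+ 2 * a2 ^+ 3 * a4 + a1 ^+ 2 * a2 ^+ 2 * a3 ^+ 2.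

Definition covariant41 P : R :=
  let: Point a0 a1 a2 a3 a4 x z := P in
  a0 * z ^+ 4 + a1 * x * z ^+ 3 + a2 * x ^+ 2 * z ^+ 2 + a3 * x ^+ 3 * z
  + a4 * x ^+ 4.

Definition covariant43 P : R :=
  let: Point a0 a1 a2 a3 a4 x z := P in
  (a0 * a4 ^+ 2 + 2 * a1 * a3 * a4 + 2 * a2 ^+ 2 * a4 + a2 * a3 ^+ 2) * x ^+ 4
  + (a0 * a3 * a4 + a1 * a2 * a4 + 2 * a1 * a3 ^+ 2) * x ^+ 3 * z
  + (a0 * a1 * a4 + a0 * a2 * a3 + 2 * a1 ^+ 2 * a3) * x * z ^+ 3
  + (a0 ^+ 2 * a4 + 2 * a0 * a1 * a3 + 2 * a0 * a2 ^+ 2 + a1 ^+ 2 * a2) * z ^+ 4.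

Definition covariant63 P : R :=
  let: Point a0 a1 a2 a3 a4 x z := P in
  (2 * a0 ^+ 2 * a3 + 2 * a0 * a1 * a2 + a1 ^+ 3) * z ^+ 6
  + (2 * a0 ^+ 2 * a4 + a0 * a1 * a3 + a0 * a2 ^+ 2 + 2 * a1 ^+ 2 * a2)
    * x * z ^+ 5
  + (a0 * a1 * a4 + a0 * a2 * a3 + 2 * a1 ^+ 2 * a3) * x ^+ 2 * z ^+ 4
  + (a0 * a3 ^+ 2 + 2 * a1 ^+ 2 * a4) * x ^+ 3 * z ^+ 3
  + (2 * a0 * a3 * a4 + 2 * a1 * a2 * a4 + a1 * a3 ^+ 2) * x ^+ 4 * z ^+ 2
  + (a0 * a4 ^+ 2 + 2 * a1 * a3 * a4 + 2 * a2 ^+ 2 * a4 + a2 * a3 ^+ 2)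
    * x ^+ 5 * z
  + (a1 * a4 ^+ 2 + a2 * a3 * a4 + 2 * a3 ^+ 3) * x ^+ 6.

End PointFunctions.

(* Stdlib's ring tactic with coefficients in Z compared modulo 3.  Its lookup  *)
(* is syntactic, so the operations of R, which occur through several           *)
(* convertible structure instances, are first folded into constants.           *)
Section Char3Identities.

Variable R : comNzRingType.
Hypothesis three0 : 3%:R = 0 :> R.

Let add (x y : R) : R := x + y.
Let opp (x : R) : R := - x.
Let mul (x y : R) : R := x * y.
Let exp (x : R) (n : nat) : R := x ^+ n.
Let nat_cst n : R := n%:R.
Let sub (x y : R) : R := add x (opp y).

Let Z_eq_mod3 (m n : Z) : bool := Z.eqb (Z.modulo (Z.sub m n) 3) 0.

Let R_ring_theory : ring_theory (nat_cst 0) (nat_cst 1) add mul sub opp eq.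
Proof. exact: RR. Qed.

Let R_morph : ring_morph (nat_cst 0) (nat_cst 1) add mul sub opp eq
  Z0 (Zpos xH) Z.add Z.mul Z.sub Z.opp Z_eq_mod3 (fun n => (int_of_Z n)%:~R).
Proof.
case: (RZ R) => m0 m1 mD mB mM mN _.
split=> // m n /Z.eqb_eq /Z.mod_divide [//|c eq_c].
have int3_0 : (int_of_Z 3)%:~R = 0 :> R := three0.
by apply/eqP; rewrite -subr_eq0 -mB eq_c mM int3_0 mulr0.
Qed.

Let R_power : power_theory (nat_cst 1) mul eq nat_of_N exp.
Proof. by case: (PN R) => PN; split. Qed.

Ltac Z_of_cst t :=
  match t with
  | nat_cst ?n => eval compute in (Z.of_nat n)
  | _ => constr:(InitialRing.NotConstant)
  end.
Ltac N_of_exponent n := eval compute in (N.of_nat n).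

Add Ring R_mod3 : R_ring_theory
  (morphism R_morph, constants [Z_of_cst], power_tac R_power [N_of_exponent]).

Ltac fold_operations :=
  repeat change (@Algebra.add _) with add;
  repeat change (@Algebra.opp _) with opp;
  repeat change (@GRing.mul _) with mul;
  repeat change (@GRing.exp _) with exp;
  repeat change (@Algebra.natmul _ (GRing.one _)) with nat_cst;
  repeat change (GRing.one _) with (nat_cst 1);
  repeat change (@Algebra.zero _) with (nat_cst 0).

Ltac ring3 :=
  fold_operations;
  match goal with |- @eq _ ?a ?b => change (@eq R a b) end; ring.

Ltac ring3_using det1 :=
  move: det1; fold_operations;
  match goal with |- @eq _ ?a ?b -> @eq _ ?c ?d =>
    change (@eq R a b -> @eq R c d) end;
  intro det1; ring [det1].

Lemma covariant01_act p q r s (P : point R) :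
  p * s = 1 + q * r -> covariant01 (act p q r s P) = covariant01 P.
Proof. case: P => a0 a1 a2 a3 a4 x z det1; rewrite /covariant01 /=.
ring3_using det1.
Qed.

Lemma covariant06_act p q r s (P : point R) :
  p * s = 1 + q * r -> covariant06 (act p q r s P) = covariant06 P.
Proof. case: P => a0 a1 a2 a3 a4 x z det1; rewrite /covariant06 /=.
ring3_using det1.
Qed.

Lemma covariant41_act p q r s (P : point R) :
  p * s = 1 + q * r -> covariant41 (act p q r s P) = covariant41 P.
Proof. case: P => a0 a1 a2 a3 a4 x z det1; rewrite /covariant41 /=.
ring3_using det1.
Qed.

Lemma covariant43_act p q r s (P : point R) :
  p * s = 1 + q * r -> covariant43 (act p q r s P) = covariant43 P.
Proof. case: P => a0 a1 a2 a3 a4 x z det1; rewrite /covariant43 /=.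
ring3_using det1.
Qed.

Lemma covariant63_act p q r s (P : point R) :
  p * s = 1 + q * r -> covariant63 (act p q r s P) = covariant63 P.
Proof. case: P => a0 a1 a2 a3 a4 x z det1; rewrite /covariant63 /=.
ring3_using det1.
Qed.

Lemma act_shift t (a0 a1 a2 a3 a4 x z : R) :
  act 1 t 0 1 (Point a0 a1 a2 a3 a4 x z)
  = Point (a0 + a1 * t + a2 * t ^+ 2 + a3 * t ^+ 3 + a4 * t ^+ 4)
      (a1 - a2 * t + a4 * t ^+ 3) a2 (a3 + a4 * t) a4 (x - t * z) z.
Proof. by congr Point; ring3. Qed.

End Char3Identities.

(* Shadows Stdlib's ring tactic. *)
From mathcomp Require Import ring.

Section Morphisms.

Variables (R S : comNzRingType) (f : {rmorphism R -> S}).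
Implicit Type P : point R.

Let morphE := (rmorph_nat, rmorphD, rmorphN, rmorphM, rmorphXn).

Lemma coords_map P s : coords (map_point f P) s = f (coords P s).
Proof.
rewrite /coords /quartic_coef /vector_coord; case: P => a0 a1 a2 a3 a4 x z /=.
by case: (split s) => [[[|[|[|[|[|//]]]]] ?]|[[|[|//]] ?]].
Qed.

Lemma act_map p q r s P :
  map_point f (act p q r s P) = act (f p) (f q) (f r) (f s) (map_point f P).
Proof. by case: P => *; rewrite /= !morphE. Qed.

Lemma covariant01_map P : covariant01 (map_point f P) = f (covariant01 P).
Proof. by case: P. Qed.

Lemma covariant06_map P : covariant06 (map_point f P) = f (covariant06 P).
Proof. by case: P => *; rewrite /= !morphE. Qed.

Lemma covariant41_map P : covariant41 (map_point f P) = f (covariant41 P).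
Proof. by case: P => *; rewrite /= !morphE. Qed.

Lemma covariant43_map P : covariant43 (map_point f P) = f (covariant43 P).
Proof. by case: P => *; rewrite /= !morphE. Qed.

Lemma covariant63_map P : covariant63 (map_point f P) = f (covariant63 P).
Proof. by case: P => *; rewrite /= !morphE. Qed.

End Morphisms.

Section QuarticAction.

Variable R : comNzRingType.
Implicit Type P : point R.

Lemma mcoeff_quartic (b : 'I_5 -> R) (i : 'I_5) :
  (quartic b)@_(quartic_mnm i) = b i.
Proof.
rewrite /quartic raddf_sum (bigD1 i) //= -quartic_mnmE mcoeffZ mcoeffX.
rewrite eqxx mulr1 big1 ?addr0 // => j ne_ji.
rewrite -quartic_mnmE mcoeffZ mcoeffX.
case: eqP => [/mnmP /(_ ord0)|_]; last by rewrite mulr0.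
rewrite !(mnm_nth 0%N) /= => eq_ji.
by case/eqP: ne_ji; apply/val_inj/eq_ji.
Qed.

Lemma eq_quartic_act (M : 'M[R]_2) (a b : 'I_5 -> R) :
  a =1 b -> quartic_act M a =1 quartic_act M b.
Proof.
move=> eq_ab i; rewrite /quartic_act /quartic_at /quartic.
by congr ((_ \mPo _)@_ _); apply: eq_bigr => j _; rewrite eq_ab.
Qed.

Lemma quartic_act_coef (M : 'M[R]_2) P :
  quartic_act M (quartic_coef P)
  =1 quartic_coef (act (M 0 0) (M 0 1) (M 1 0) (M 1 1) P).
Proof.
move=> i; rewrite -[RHS]mcoeff_quartic /quartic_act; congr (_@_ _).
rewrite /quartic_at /quartic !big_ord_recl !big_ord0 /quartic_coef /=.
case: P => a0 a1 a2 a3 a4 x z.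
rewrite /= !(comp_mpolyD, comp_mpolyZ, rmorphM, rmorphXn) /=.
rewrite !comp_mpoly0 !comp_mpolyXU.
rewrite -!tnth_nth !tnth_mktuple !big_ord_recl !big_ord0 /=.
rewrite -!mul_mpolyC.
have -> : lift ord0 ord0 = 1 :> 'I_2 by apply: val_inj.
ring.
Qed.

End QuarticAction.

Section SL2Substitution.

Variable k : fieldType.

Definition generic_point : point {mpoly k[5 + 2]} :=
  Point (Xa k 0) (Xa k 1) (Xa k 2) (Xa k 3) (Xa k 4) (Xw k 0) (Xw k 1).

Lemma map_generic_point (S : comNzRingType)
    (f : {rmorphism {mpoly k[5 + 2]} -> S}) P :
  (forall s, f 'X_(s : 'I_(5 + 2)) = coords P s) ->
  map_point f generic_point = P.
Proof.
case: P => a0 a1 a2 a3 a4 x z fX; rewrite /= /Xa /Xw !fX /coords.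
by rewrite !(unsplitK (inl _)) !(unsplitK (inr _)).
Qed.

Lemma comp_generic_point (P : point {mpoly k[5 + 2]}) :
  map_point (comp_mpoly [tuple coords P s | s < 5 + 2]) generic_point = P.
Proof.
apply: map_generic_point => s.
by rewrite /= comp_mpolyXU -tnth_nth tnth_mktuple.
Qed.

Lemma exists_point (u : 'I_(5 + 2) -> k) : exists P, u =1 coords P.
Proof.
pose a i := u (lshift 2 i); pose w j := u (rshift 5 j).
exists (Point (a 0) (a 1) (a 2) (a 3) (a 4) (w 0) (w 1)) => s.
rewrite /coords /quartic_coef /vector_coord -{1}(splitK s).
case: (split s) => [] [] /=; first case=> [|[|[|[|[|//]]]]] ? /=.
1-5: by congr u; apply: val_inj.
by case=> [|[|//]] ? /=; congr u; apply: val_inj.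
Qed.

Lemma map_meval_generic_point (P : point k) :
  map_point (meval (coords P)) generic_point = P.
Proof. by apply: map_generic_point => s; rewrite /= mevalXU. Qed.

Lemma invmx_det1 (M : 'M[k]_2) :
  \det M = 1 ->
  [/\ invmx M 0 0 = M 1 1, invmx M 0 1 = - M 0 1,
      invmx M 1 0 = - M 1 0 & invmx M 1 1 = M 0 0].
Proof.
move=> det1; rewrite /invmx unitmxE det1 unitr1 invr1 scale1r !mxE.
rewrite /cofactor !det_mx11 !mxE.
have -> : lift 0 0 = 1 :> 'I_2 by apply: val_inj.
have -> : lift 1 0 = 0 :> 'I_2 by apply: val_inj.
by split => /=; ring.
Qed.

Lemma SL2_substE (M : 'M[k]_2) (h : {mpoly k[5 + 2]}) : \det M = 1 ->
  SL2_subst M h = h \mPo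
    [tuple coords (act (M 0 0)%:MP (M 0 1)%:MP (M 1 0)%:MP (M 1 1)%:MP
                     generic_point) s | s < 5 + 2].
Proof.
move=> det1; congr (_ \mPo _); apply/eq_from_tnth => s; rewrite !tnth_mktuple.
rewrite /coords; case: (split s) => [i|j].
  have Xa_coef : Xa k =1 quartic_coef generic_point.
    rewrite /quartic_coef; case=> [[|[|[|[|[|//]]]]] ?]; congr Xa;
    exact: val_inj.
  by rewrite (eq_quartic_act _ Xa_coef) quartic_act_coef !mxE.
have [e00 e01 e10 e11] := invmx_det1 det1.
rewrite !big_ord_recl big_ord0 addr0 /vector_coord /= -!mul_mpolyC.
have -> : lift ord0 ord0 = 1 :> 'I_2 by apply: val_inj.
case: j => [[|[|//]] lt_j2] /=.
  rewrite (_ : Ordinal lt_j2 = 0); last exact: val_inj.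
  by rewrite e00 e01 rmorphN; ring.
rewrite (_ : Ordinal lt_j2 = 1) ?e10 ?e11; last exact: val_inj.
by rewrite rmorphN; ring.
Qed.

Lemma det2 (R : comNzRingType) (M : 'M[R]_2) :
  \det M = M 0 0 * M 1 1 - M 0 1 * M 1 0.
Proof.
rewrite (expand_det_row _ 0) !big_ord_recl big_ord0 /cofactor !det_mx11 !mxE.
have -> : lift ord0 ord0 = 1 :> 'I_2 by apply: val_inj.
have -> : lift 1 0 = 0 :> 'I_2 by apply: val_inj.
by rewrite /=; ring.
Qed.

Lemma meval_SL2_subst (M : 'M[k]_2) (h : {mpoly k[5 + 2]}) P : \det M = 1 ->
  (SL2_subst M h).@[coords P]
  = h.@[coords (act (M 0 0) (M 0 1) (M 1 0) (M 1 1) P)].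
Proof.
move=> det1; rewrite SL2_substE // comp_mpoly_meval; apply: meval_eq => s.
rewrite tnth_mktuple -coords_map act_map map_meval_generic_point.
by rewrite /= !mevalC.
Qed.

Lemma invariant_act (h : {mpoly k[5 + 2]}) p q r s P :
  Defs.invariant (@SL2_group k) h -> p * s = 1 + q * r ->
  h.@[coords (act p q r s P)] = h.@[coords P].
Proof.
move=> inv_h det1.
pose M : 'M[k]_2 := \matrix_(i, j) (if i == 0 then if j == 0 then p else q
                                     else if j == 0 then r else s).
have detM : \det M = 1 by rewrite det2 !mxE /= det1 addrK.
have -> : act p q r s P = act (M 0 0) (M 0 1) (M 1 0) (M 1 1) P by rewrite !mxE.
by rewrite -meval_SL2_subst // inv_h //; exists M.
Qed.

Lemma invariant_generic (c : point {mpoly k[5 + 2]} -> {mpoly k[5 + 2]}) :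
  (forall f : {rmorphism {mpoly k[5 + 2]} -> {mpoly k[5 + 2]}},
     c (map_point f generic_point) = f (c generic_point)) ->
  (forall p q r s P, p * s = 1 + q * r -> c (act p q r s P) = c P) ->
  Defs.invariant (@SL2_group k) (c generic_point).
Proof.
move=> c_map c_act _ [M det1 ->]; rewrite SL2_substE //.
rewrite -(c_map (comp_mpoly _)) comp_generic_point c_act //.
by rewrite -!mpolyCM -mpolyC1 -mpolyCD -det1 det2 subrK.
Qed.

End SL2Substitution.

Section Separation.

Variable k : closedFieldType.
Hypothesis char_k : 3%N \in [pchar k].

Let three0 : 3%:R = 0 :> k.
Proof. exact: pcharf0 char_k. Qed.

Definition indistinguishable (P Q : point k) : Prop :=
  forall h, Defs.invariant (@SL2_group k) h -> h.@[coords P] = h.@[coords Q].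

Lemma indist_sym P Q : indistinguishable P Q -> indistinguishable Q P.
Proof. by move=> PQ h /PQ. Qed.

Lemma indist_trans P Q S :
  indistinguishable P Q -> indistinguishable Q S -> indistinguishable P S.
Proof. by move=> PQ QS h inv_h; rewrite PQ ?QS. Qed.

Lemma indist_act p q r s P :
  p * s = 1 + q * r -> indistinguishable P (act p q r s P).
Proof. by move=> det1 h inv_h; rewrite invariant_act. Qed.

Lemma indist_limit (gamma : point {poly k}) P :
  (forall t, t != 0 -> indistinguishable P (map_point (horner_eval t) gamma)) ->
  indistinguishable P (map_point (horner_eval 0) gamma).
Proof.
move=> gammaP h inv_h; set c := h.@[_].
pose H := \sum_(m <- msupp h) h@_m *: \prod_i coords gamma i ^+ m i.
have H_eval t : H.[t] = h.@[coords (map_point (horner_eval t) gamma)].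
  rewrite mevalE horner_sum; apply: eq_bigr => m _.
  rewrite hornerZ horner_prod; congr (_ * _); apply: eq_bigr => i _.
  by rewrite horner_exp coords_map.
(* H - c vanishes at every t <> 0; the factor 'X takes care of t = 0. *)
have : 'X * (H - c%:P) == 0.
  apply: contraT => /closed_nonrootP[t]; rewrite rootM rootX negb_or.
  case/andP=> t0; rewrite /root hornerD hornerN hornerC H_eval.
  by rewrite -(gammaP t t0) // subrr eqxx.
rewrite mulf_eq0 polyX_eq0 subr_eq0 /= => /eqP eqH.
by rewrite -H_eval eqH hornerC.
Qed.

Lemma three0_mpoly : 3%:R = 0 :> {mpoly k[5 + 2]}.
Proof. by rewrite -mpolyC_nat three0 mpolyC0. Qed.

Lemma invariants :
  [/\ Defs.invariant (@SL2_group k) (c01 k),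
      Defs.invariant (@SL2_group k) (c06 k),
      Defs.invariant (@SL2_group k) (c41 k),
      Defs.invariant (@SL2_group k) (c43 k) &
      Defs.invariant (@SL2_group k) (c63 k)].
Proof.
split.
- apply: (@invariant_generic _ (@covariant01 _)) => [f|p q r s P det1].
    exact: covariant01_map.
  exact: (covariant01_act three0_mpoly).
- apply: (@invariant_generic _ (@covariant06 _)) => [f|p q r s P det1].
    exact: covariant06_map.
  exact: (covariant06_act three0_mpoly).
- apply: (@invariant_generic _ (@covariant41 _)) => [f|p q r s P det1].
    exact: covariant41_map.
  exact: (covariant41_act three0_mpoly).
- apply: (@invariant_generic _ (@covariant43 _)) => [f|p q r s P det1].
    exact: covariant43_map.
  exact: (covariant43_act three0_mpoly).
- apply: (@invariant_generic _ (@covariant63 _)) => [f|p q r s P det1].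
    exact: covariant63_map.
  exact: (covariant63_act three0_mpoly).
Qed.

Definition same_covariants (P Q : point k) : Prop :=
  [/\ covariant01 P = covariant01 Q, covariant06 P = covariant06 Q,
      covariant41 P = covariant41 Q, covariant43 P = covariant43 Q &
      covariant63 P = covariant63 Q].

Lemma meval_covariants P :
  [/\ (c01 k).@[coords P] = covariant01 P, (c06 k).@[coords P] = covariant06 P,
      (c41 k).@[coords P] = covariant41 P, (c43 k).@[coords P] = covariant43 P &
      (c63 k).@[coords P] = covariant63 P].
Proof.
rewrite -{2 4 6 8 10}(map_meval_generic_point P).
rewrite covariant01_map covariant06_map covariant41_map covariant43_map.
by rewrite covariant63_map.
Qed.

Lemma indist_same_covariants P Q : indistinguishable P Q -> same_covariants P Q.
Proof.
have [i1 i2 i3 i4 i5] := invariants; move=> PQ; move: (meval_covariants P).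
rewrite !PQ //; have [-> -> -> -> ->] := meval_covariants Q.
by case=> *; split.
Qed.

Lemma exists_sqrt_inv (a : k) : a != 0 -> exists2 t, t != 0 & t ^+ 2 * a = 1.
Proof.
move=> a0; have [t Et] := @solve_monicpoly k 2 (nth 0 [:: a^-1]) isT.
rewrite !big_ord_recl big_ord0 /= mul0r mulr1 !addr0 in Et.
exists t; last by rewrite Et mulVf.
by apply: contra_eq_neq Et => ->; rewrite expr0n eq_sym invr_eq0.
Qed.

Lemma exists_cubic_root (a b c : k) :
  a != 0 -> exists t, c + b * t + a * t ^+ 3 = 0.
Proof.
move=> a0.
have [t Et] := @solve_monicpoly k 3 (nth 0 [:: - c / a; - b / a]) isT.
by exists t; rewrite Et !big_ord_recl big_ord0 /=; field.
Qed.

Lemma exists_quartic_root (a0 a1 a2 a3 a4 : k) :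
  exists p q r s, p * s = 1 + q * r
    /\ a0 * r ^+ 4 + a1 * p * r ^+ 3 + a2 * p ^+ 2 * r ^+ 2 + a3 * p ^+ 3 * r
       + a4 * p ^+ 4 = 0.
Proof.
have [->|a4n0] := eqVneq a4 0.
  by exists 1, 0, 0, 1; split; ring.
have [t Et] := @solve_monicpoly k 4
  (nth 0 [:: - a0 / a4; - a1 / a4; - a2 / a4; - a3 / a4]) isT.
exists t, (- 1), 1, 0; split; first by ring.
by rewrite Et !big_ord_recl big_ord0 /=; field.
Qed.

Lemma indist_shift t a0 a1 a2 a3 a4 x z :
  indistinguishable (Point a0 a1 a2 a3 a4 x z)
    (Point (a0 + a1 * t + a2 * t ^+ 2 + a3 * t ^+ 3 + a4 * t ^+ 4)
       (a1 - a2 * t + a4 * t ^+ 3) a2 (a3 + a4 * t) a4 (x - t * z) z).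
Proof. by rewrite -act_shift //; apply: indist_act; ring. Qed.

Lemma indist_scale t a0 a1 a2 a3 a4 x z : t != 0 ->
  indistinguishable (Point a0 a1 a2 a3 a4 x z)
    (Point (a0 / t ^+ 4) (a1 / t ^+ 2) a2 (a3 * t ^+ 2) (a4 * t ^+ 4)
       (x / t) (t * z)).
Proof.
move=> t0; have := @indist_act t 0 0 t^-1 (Point a0 a1 a2 a3 a4 x z).
rewrite mul0r addr0 mulfV // => /(_ erefl); congr (indistinguishable _ _).
by congr Point; field.
Qed.

Lemma indist_double_root a0 a1 a2 x :
  indistinguishable (Point a0 a1 a2 0 0 x 0) (Point 0 0 a2 0 0 0 0).
Proof.
have -> : Point 0 0 a2 0 0 0 0 = map_point (horner_eval 0)
    (Point (a0 *: 'X ^+ 4) (a1 *: 'X ^+ 2) a2%:P 0 0 (x *: 'X) 0).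
  rewrite /= /horner_eval !(hornerZ, hornerXn, hornerX, hornerC).
  by rewrite !expr0n !mulr0.
apply: indist_limit => t t0; have ti0 : t^-1 != 0 by rewrite invr_eq0.
have := @indist_scale t^-1 a0 a1 a2 0 0 x 0 ti0.
congr (indistinguishable _ _); rewrite /= /horner_eval.
rewrite !(hornerZ, hornerXn, hornerX, hornerC, horner0).
by congr Point; rewrite ?exprVn ?invrK ?mul0r ?mulr0.
Qed.

Lemma indist_kill_a3 a2 :
  indistinguishable (Point 0 0 a2 1 0 0 0) (Point 0 0 a2 0 0 0 0).
Proof.
have -> : Point 0 0 a2 0 0 0 0 = map_point (horner_eval 0)
    (Point 0 0 a2%:P ('X ^+ 2) 0 0 0).
  by rewrite /= /horner_eval !(hornerXn, hornerC) expr0n.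
apply: indist_limit => t t0; have := @indist_scale t 0 0 a2 1 0 0 0 t0.
congr (indistinguishable _ _); rewrite /= /horner_eval.
rewrite !(hornerZ, hornerXn, hornerX, hornerC, horner0).
by congr Point; field.
Qed.

Lemma indist_vector_normal P : (px P, pz P) != (0, 0) ->
  exists a0 a1 a2 a3 a4, indistinguishable P (Point a0 a1 a2 a3 a4 1 0).
Proof.
case: P => a0 a1 a2 a3 a4 x z; rewrite xpair_eqE negb_and /= => xz0.
have [q [s det1]] : exists q s, x * s = 1 + q * z.
  have [x0|x0] := eqVneq x 0.
    exists (- z^-1), 0; rewrite mulr0 mulNr mulVf ?subrr //.
    by move: xz0; rewrite x0 eqxx.
  by exists 0, x^-1; rewrite mul0r addr0 mulfV.
have := @indist_act x q z s (Point a0 a1 a2 a3 a4 x z) det1.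
rewrite /= [x * z]mulrC subrr [s * x]mulrC det1 addrK.
by move=> ?; do 5!eexists; eassumption.
Qed.

Lemma indist_zero_normal a0 a1 a2 a3 a4 :
  exists b0 b1,
    indistinguishable (Point a0 a1 a2 a3 a4 0 0) (Point b0 b1 a2 1 0 0 0).
Proof.
have [p [q [r [s [det1 root]]]]] := exists_quartic_root a0 a1 a2 a3 a4.
have act_P := @indist_act p q r s (Point a0 a1 a2 a3 a4 0 0) det1.
move: (act_P); have [+ _ _ _ _] := indist_same_covariants act_P.
rewrite /covariant01 /= root => <-.
move: (_ + _) (_ + _) (_ + _) => c3 c1 c0.
rewrite !mulr0 !subrr => PQ.
have [c30|c30] := eqVneq c3 0.
  exists 0, 0; apply: (indist_trans PQ); rewrite c30.
  apply: indist_trans (indist_double_root _ _ _ _) _.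
  exact: indist_sym (indist_kill_a3 _).
have [t t0 Et] := exists_sqrt_inv c30.
have := indist_trans PQ (@indist_scale t c0 c1 a2 c3 0 0 0 t0).
rewrite [c3 * _]mulrC Et !mul0r mulr0.
by exists (c0 / t ^+ 4), (c1 / t ^+ 2).
Qed.

Let two_neq0 : 2 != 0 :> k.
Proof.
have -> : 2 = - 1 :> k by apply/eqP; rewrite -subr_eq0 opprK natr1 three0.
by rewrite oppr_eq0 oner_eq0.
Qed.

Let cube_inj (a b : k) : a ^+ 3 = b ^+ 3 -> a = b.
Proof.
move=> eq3; apply: (fmorph_inj (pFrobenius_aut char_k)).
by rewrite /= !pFrobenius_autE.
Qed.

Lemma indist_simple_root_at_infinity a0 a1 b0 b1 a2 a3 x : a3 != 0 ->
  covariant06 (Point a0 a1 a2 a3 0 x 0)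
  = covariant06 (Point b0 b1 a2 a3 0 x 0) ->
  indistinguishable (Point a0 a1 a2 a3 0 x 0) (Point b0 b1 a2 a3 0 x 0).
Proof.
move=> a30.
have [->|a20] := eqVneq a2 0.
  have normal c0 c1 : exists d1,
      indistinguishable (Point c0 c1 0 a3 0 x 0) (Point 0 d1 0 a3 0 x 0).
    have [t Et] := exists_cubic_root c1 c0 a30.
    have := @indist_shift t c0 c1 0 a3 0 x 0.
    by rewrite !mul0r !mulr0 !addr0 !subr0 Et; exists c1.
  have [d1 ad] := normal a0 a1; have [e1 be] := normal b0 b1.
  have [_ -> _ _ _] := indist_same_covariants ad.
  have [_ -> _ _ _] := indist_same_covariants be.
  move=> /= eq06; suff eq1 : d1 = e1.
    by rewrite eq1 in ad; exact: indist_trans ad (indist_sym be).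
  apply: cube_inj; apply: (@mulfI _ (2 * a3 ^+ 3)).
    by rewrite mulf_neq0 ?expf_neq0.
  by move: eq06; congr (_ = _); ring.
have normal c0 c1 : exists d0,
    indistinguishable (Point c0 c1 a2 a3 0 x 0) (Point d0 0 a2 a3 0 x 0).
  have := @indist_shift (c1 / a2) c0 c1 a2 a3 0 x 0.
  rewrite [a2 * (c1 / a2)]mulrC divfK // subrr !mul0r mulr0 !addr0 subr0.
  by move=> ?; eexists; eassumption.
have [d0 ad] := normal a0 a1; have [e0 be] := normal b0 b1.
have [_ -> _ _ _] := indist_same_covariants ad.
have [_ -> _ _ _] := indist_same_covariants be.
move=> /= eq06; suff eq0 : d0 = e0.
  by rewrite eq0 in ad; exact: indist_trans ad (indist_sym be).
apply: (@mulfI _ (2 * a2 ^+ 3 * a3 ^+ 2)).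
  by rewrite !mulf_neq0 ?expf_neq0.
by move: eq06; congr (_ = _); ring.
Qed.

Lemma indist_no_root_at_infinity a0 a1 a2 a3 a4 b0 b1 b3 : a4 != 0 ->
  same_covariants (Point a0 a1 a2 a3 a4 1 0) (Point b0 b1 a2 b3 a4 1 0) ->
  indistinguishable (Point a0 a1 a2 a3 a4 1 0) (Point b0 b1 a2 b3 a4 1 0).
Proof.
move=> a40.
have normal c0 c1 c3 : exists d0 d1,
    indistinguishable (Point c0 c1 a2 c3 a4 1 0) (Point d0 d1 a2 0 a4 1 0).
  have := @indist_shift (- c3 / a4) c0 c1 a2 c3 a4 1 0.
  rewrite [a4 * (_ / a4)]mulrC divfK // subrr mulr0 subr0.
  by move=> ?; do 2!eexists; eassumption.
have [d0 [d1 ad]] := normal a0 a1 a3; have [e0 [e1 be]] := normal b0 b1 b3.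
rewrite /same_covariants.
case: (indist_same_covariants ad) => _ _ _ -> ->.
case: (indist_same_covariants be) => _ _ _ -> ->.
case=> _ _ _ /= eq43 eq63.
have a4sq0 : a4 ^+ 2 != 0 by rewrite expf_neq0.
have eq0 : d0 = e0.
  apply: (mulfI a4sq0); move/(congr1 (fun y => y - 2 * a2 ^+ 2 * a4)): eq43.
  by congr (_ = _); ring.
have eq1 : d1 = e1.
  by apply: (mulfI a4sq0); move: eq63; congr (_ = _); ring.
by rewrite eq0 eq1 in ad; exact: indist_trans ad (indist_sym be).
Qed.

Lemma indist_zero_vector a0 a1 a2 a3 a4 b0 b1 b2 b3 b4 :
  same_covariants (Point a0 a1 a2 a3 a4 0 0) (Point b0 b1 b2 b3 b4 0 0) ->
  indistinguishable (Point a0 a1 a2 a3 a4 0 0) (Point b0 b1 b2 b3 b4 0 0).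
Proof.
have [c0 [c1 ac]] := indist_zero_normal a0 a1 a2 a3 a4.
have [d0 [d1 bd]] := indist_zero_normal b0 b1 b2 b3 b4.
rewrite /same_covariants; have [_ -> _ _ _] := indist_same_covariants ac.
have [_ -> _ _ _] := indist_same_covariants bd.
case=> [/= eq01 eq06 _ _ _]; rewrite /covariant01 /= in eq01; subst b2.
apply: (indist_trans ac); apply: indist_trans (indist_sym bd).
exact: indist_simple_root_at_infinity (oner_neq0 _) eq06.
Qed.

Lemma indist_common_vector a0 a1 a2 a3 a4 b0 b1 b2 b3 b4 :
  same_covariants (Point a0 a1 a2 a3 a4 1 0) (Point b0 b1 b2 b3 b4 1 0) ->
  indistinguishable (Point a0 a1 a2 a3 a4 1 0) (Point b0 b1 b2 b3 b4 1 0).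
Proof.
move=> same; have [eq01 eq06 eq41 eq43 eq63] := same.
rewrite /covariant01 /= in eq01; subst b2.
have eq4 : a4 = b4 by move: eq41; rewrite /=; congr (_ = _); ring.
subst b4; have [a40|a40] := eqVneq a4 0; last exact: indist_no_root_at_infinity.
subst a4; have eq3 : a3 = b3.
  apply: cube_inj; apply: (mulfI two_neq0).
  by move: eq63; rewrite /=; congr (_ = _); ring.
subst b3; have [a30|a30] := eqVneq a3 0.
  subst a3.
  apply: indist_trans (indist_double_root _ _ _ _) _.
  exact: indist_sym (indist_double_root _ _ _ _).
exact: indist_simple_root_at_infinity.
Qed.

Lemma indist_nonzero_zero_vector a0 a1 a2 a3 a4 b0 b1 b2 b3 b4 :
  same_covariants (Point a0 a1 a2 a3 a4 1 0) (Point b0 b1 b2 b3 b4 0 0) ->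
  indistinguishable (Point a0 a1 a2 a3 a4 1 0) (Point b0 b1 b2 b3 b4 0 0).
Proof.
move=> same; have [_ _ eq41 _ eq63] := same.
have a40 : a4 = 0 by move: eq41; rewrite /=; congr (_ = _); ring.
subst a4; have a30 : a3 = 0.
  apply: cube_inj; apply: (mulfI two_neq0).
  by move: eq63; rewrite /=; congr (_ = _); ring.
subst a3; apply: indist_trans (indist_double_root _ _ _ _) _.
apply: indist_zero_vector; move: same; rewrite /same_covariants.
have [-> -> -> -> ->] :=
  indist_same_covariants (indist_double_root a0 a1 a2 1).
by [].
Qed.

Lemma same_covariants_sym P Q : same_covariants P Q -> same_covariants Q P.
Proof. by case=> *; split. Qed.

Lemma same_covariants_trans P Q S :
  same_covariants P Q -> same_covariants Q S -> same_covariants P S.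
Proof. by rewrite /same_covariants => -[-> -> -> -> ->]. Qed.

Lemma same_covariants_indist P Q :
  same_covariants P Q -> indistinguishable P Q.
Proof.
have normal S : exists a0 a1 a2 a3 a4,
    indistinguishable S (Point a0 a1 a2 a3 a4 1 0)
    \/ indistinguishable S (Point a0 a1 a2 a3 a4 0 0).
  have [eqS|/indist_vector_normal[a0 [a1 [a2 [a3 [a4 ?]]]]]] :=
    eqVneq (px S, pz S) (0, 0); last by exists a0, a1, a2, a3, a4; left.
  case: S eqS => a0 a1 a2 a3 a4 x z [/= -> ->].
  by exists a0, a1, a2, a3, a4; right.
have [a0 [a1 [a2 [a3 [a4 Pa]]]]] := normal P.
have [b0 [b1 [b2 [b3 [b4 Qb]]]]] := normal Q.
move=> same.
have transfer P' Q' : indistinguishable P P' -> indistinguishable Q Q' ->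
    (same_covariants P' Q' -> indistinguishable P' Q') -> indistinguishable P Q.
  move=> PP' QQ' P'Q'; apply: (indist_trans PP').
  apply: indist_trans (indist_sym QQ').
  apply: P'Q'; apply: same_covariants_trans (indist_same_covariants QQ').
  exact: same_covariants_trans (indist_same_covariants (indist_sym PP')) same.
case: Pa => Pa; case: Qb => Qb; apply: (transfer _ _ Pa Qb).
- exact: indist_common_vector.
- exact: indist_nonzero_zero_vector.
- by move/same_covariants_sym/indist_nonzero_zero_vector/indist_sym.
- exact: indist_zero_vector.
Qed.

End Separation.

Theorem mainTheorem2 (k : closedFieldType) (char_k : (3%N \in [pchar k])) :
  separating (@SL2_group k)
    (fun c => c \in [:: c01 k; c06 k; c41 k; c43 k; c63 k]).
Proof.
have [inv01 inv06 inv41 inv43 inv63] := invariants char_k; split.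
  by move=> c; rewrite !inE => /or4P[||| /orP[]] /eqP ->.
move=> u v [h [inv_h h_uv]].
have [U uE] := exists_point u; have [V vE] := exists_point v.
have evalE w W (wE : w =1 coords W) g : g.@[w] = g.@[coords W].
  exact: meval_eq.
pose differs :=
  has (fun c : {mpoly k[5 + 2]} => c.@[coords U] != c.@[coords V])
      [:: c01 k; c06 k; c41 k; c43 k; c63 k].
have [/hasP[c c_in /eqP c_uv]|same] := boolP differs.
  by exists c; rewrite !(evalE _ _ _ uE) !(evalE _ _ _ vE).
case: h_uv; rewrite (evalE _ _ _ uE) (evalE _ _ _ vE).
apply: same_covariants_indist => //; move: same.
rewrite /differs /= orbF !negb_or !negbK.
have [-> -> -> -> ->] := meval_covariants U.
have [-> -> -> -> ->] := meval_covariants V.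
by case/and5P=> /eqP ? /eqP ? /eqP ? /eqP ? /eqP ?; split.
Qed.
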